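(* Let $r \in \mathbb{N}$. Then $\mathsf{D}_2(C_2^r) < (3r + 6)/2$.
   Context: $C_2^r$ is the elementary abelian $2$-group of rank $r$. A sequence over a finite abelian group $G$ is a finite unordered list of elements of $G$ with repetitions allowed; it is zero-sum if its terms sum to $0$. $\mathsf{D}_k(G)$ is the smallest integer $\ell$ such that every sequence over $G$ of length at least $\ell$ has $k$ disjoint non-empty zero-sum subsequences. *)

(* Defs.v *)
From mathcomp Require Import all_boot all_algebra.
Set Implicit Arguments. Unset Strict Implicit. Unset Printing Implicit Defensive.
Import GRing.Theory.
Local Open Scope ring_scope.

(* A sequence over G is a list s; its subsequences are given by sets of
   positions in 'I_(size s).  The sequence s has k disjoint non-empty
   zero-sum subsequences iff there are k pairwise disjoint non-empty sets of
   positions, each of whose terms sum to 0. *)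
Definition has_k_disjoint_zs (G : finZmodType) (k : nat) (s : seq G) : Prop :=
  exists F : 'I_k -> {set 'I_(size s)},
    (forall i, F i != set0) /\
    (forall i, \sum_(j in F i) nth 0 s j = 0) /\
    (forall i i', i != i' -> [disjoint F i & F i']).

Definition Dk_prop (G : finZmodType) (k l : nat) : Prop :=
  forall s : seq G, (l <= size s)%N -> has_k_disjoint_zs k s.

Definition is_Dk (G : finZmodType) (k l : nat) : Prop :=
  Dk_prop G k l /\ forall l', Dk_prop G k l' -> (l <= l')%N.

Definition C2pow (r : nat) : finZmodType := 'rV['F_2]_r.

(* Main.v *)
(** Let [k] be the dimension of the binary code of linear relations among the
    [n] terms of the sequence, so that [k >= n - r].  Two disjoint non-empty
    zero-sum subsequences are two non-zero codewords with disjoint supports.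
    Suppose there are none, and let [f] be a codeword of maximal weight [w].
    A codeword [v] other than [0] and [f] cannot be supported inside [supp f],
    since [v] and [f + v] would be disjoint; so deleting the coordinates of
    [supp f] leaves a code of dimension [k - 1], which has a word with at least
    [k - 1] ones.  For a lift [g] of this word,
    [2 w >= wt g + wt (f + g) >= w + 2 (k - 1)], hence [w >= 2 (k - 1)] and
    [n >= w + (k - 1) >= 3 (k - 1)].  This fails as soon as
    [2 n >= 3 r + 4]. *)
Require Import Defs.
From mathcomp Require Import all_boot all_algebra.
From mathcomp Require Import zify.
From Stdlib Require Import Classical Wf_nat.
Set Implicit Arguments. Unset Strict Implicit. Unset Printing Implicit Defensive.
Import GRing.Theory.
Local Open Scope ring_scope.

Definition supp (F : fieldType) n (v : 'rV[F]_n) : {set 'I_n} :=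
  [set j | v 0 j != 0].

Lemma supp_eq0 (F : fieldType) n (v : 'rV[F]_n) : (supp v == set0) = (v == 0).
Proof.
apply/eqP/eqP => [v0 | ->]; last by apply/setP=> j; rewrite !inE mxE eqxx.
apply/rowP=> j; rewrite mxE; apply/eqP/negPn.
by have /setP/(_ j) := v0; rewrite !inE => ->.
Qed.

(** On [\rank C] linearly independent columns the row space projects onto the whole space, so some
    codeword is 1 at all these positions. *)
Lemma rank_le_card_supp (F : fieldType) m n (C : 'M[F]_(m, n)) :
  exists u : 'rV_m, (\rank C <= #|supp (u *m C)|)%N.
Proof.
pose f := maxrankfun C^T.
have full : row_full (colsub f C).
  have: row_free (rowsub f C^T) by rewrite maxrowsub_free.
  by rewrite /row_free /row_full -mxrank_tr trmx_mxsub trmxK.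
have /submxP [u Eu] : ((const_mx 1 : 'rV_(\rank C^T)) <= colsub f C)%MS.
  exact: submx_full.
exists u; rewrite -mxrank_tr -[X in (X <= _)%N]card_ord.
rewrite -(card_imset predT (@maxrankfun_inj _ _ _ C^T)).
apply/subset_leq_card/subsetP=> _ /imsetP [i _ ->].
have /rowP/(_ i) := Eu.
rewrite -/f inE mulmx_colsub !mxE => <-; exact: oner_neq0.
Qed.

Lemma F2_neq0 (x : 'F_2) : (x != 0) = (x == 1).
Proof. by case: x => [[|[|]]]. Qed.

Lemma F2_add_neq0 (x y : 'F_2) : (x + y != 0) = (x != 0) (+) (y != 0).
Proof. by case: x y => [[|[|]]] // ? [[|[|]]]. Qed.

Lemma suppD (n : nat) (f g : 'rV['F_2]_n) :
  supp (f + g) = (supp f :\: supp g) :|: (supp g :\: supp f).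
Proof.
by apply/setP=> j; rewrite !inE mxE F2_add_neq0; do 2 case: (_ != 0).
Qed.

(** A position in [supp f] lies in exactly one of [supp g] and [supp (f + g)]; any other lies in
    both or in neither. *)
Lemma card_suppD (n : nat) (f g : 'rV['F_2]_n) :
  (#|supp g| + #|supp (f + g)| = #|supp f| + #|supp g :\: supp f|.*2)%N.
Proof.
rewrite suppD cardsU.
have -> : (supp f :\: supp g) :&: (supp g :\: supp f) = set0.
  by apply/setP=> j; rewrite !inE; do 2 case: (_ != 0).
have := cardsID (supp f) (supp g); have := cardsID (supp g) (supp f).
rewrite cards0 (setIC (supp g)); lia.
Qed.

Lemma intersecting_code_length m n (C : 'M['F_2]_(m, n)) :
  (forall u v : 'rV_n, (u <= C)%MS -> (v <= C)%MS -> u != 0 -> v != 0 ->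
     ~~ [disjoint supp u & supp v]) ->
  (3 * (\rank C).-1 <= n)%N.
Proof.
move=> int.
pose u0 := [arg max_(u > 0 : 'rV_m) #|supp (u *m C)|].
pose f := u0 *m C.
have fmax u : (#|supp (u *m C)| <= #|supp f|)%N.
  by rewrite /f /u0; case: arg_maxnP => // v _; apply.
have fC : (f <= C)%MS := submxMl _ _.
have [f0 | nzf] := eqVneq f 0.
  have [u] := rank_le_card_supp C; have := fmax u.
  have /eqP -> : supp f == set0 by rewrite supp_eq0 f0.
  by rewrite cards0 leqn0 => /eqP ->; rewrite leqn0 => /eqP ->.
(* Coordinates in [supp f] are zeroed rather than removed, so that all supports stay in ['I_n]. *)
pose D : 'M['F_2]_n := diag_mx (\row_j (f 0 j == 0)%:R).
have DE (v : 'rV_n) j : (v *m D) 0 j = v 0 j * (f 0 j == 0)%:R.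
  by rewrite mul_mx_diag !mxE.
have kerD : (C :&: kermx D <= f)%MS.
  apply/rV_subP=> v; rewrite sub_capmx => /andP [vC /sub_kermxP vD].
  have [-> | nzv] := eqVneq v 0; first exact: sub0mx.
  have [-> // | nvf] := eqVneq v f.
  have sub : supp v \subset supp f.
    apply/subsetP=> j; rewrite !inE; apply: contraNN => fj.
    by have /rowP/(_ j) := vD; rewrite DE fj mulr1 mxE => ->.
  have nzfv : f + v != 0.
    apply: contra_neq nvf => /eqP; rewrite addr_eq0 => /eqP ->.
    by apply/rowP=> j; rewrite !mxE; case: (v 0 j) => [[|[|]]] //= ?; apply/val_inj.
  have /negP := int v (f + v) vC (addmx_sub fC vC) nzv nzfv; case.
  rewrite suppD disjoints_subset; apply/subsetP=> j vj.
  by move/subsetP/(_ j vj): sub; move: vj; rewrite !inE => -> ->.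
have rkD : ((\rank C).-1 <= \rank (C *m D))%N.
  rewrite -(mxrank_mul_ker C D) -subn1 leq_subLR addnC leq_add2r.
  exact: leq_trans (mxrankS kerD) (rank_leq_row f).
have [u] := rank_le_card_supp (C *m D).
have -> : supp (u *m (C *m D)) = supp (u *m C) :\: supp f.
  apply/setP=> j; rewrite mulmxA !inE DE mulf_eq0.
  by case: (f 0 j == 0); rewrite ?oner_eq0 ?eqxx ?orbF ?orbT.
move=> rkb; set g := u *m C in rkb.
have := card_suppD f g; have := fmax u.
have := fmax (u0 + u); rewrite mulmxDl -/f -/g.
have : (#|supp f| + #|supp g :\: supp f| <= n)%N.
  rewrite -cardsUI; have -> : supp f :&: (supp g :\: supp f) = set0.
    by apply/setP=> j; rewrite !inE; do 2 case: (_ != 0).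
  by rewrite cards0 addn0 -[X in (_ <= X)%N]card_ord max_card.
move: (leq_trans rkD rkb); rewrite -/g.
move: (\rank C).-1 #|supp f| #|supp g| #|supp (f + g)| #|supp g :\: supp f|.
lia.
Qed.

(** Coefficients in ['F_2] are 0 or 1; hence zero-sum sets of positions are the supports of vectors
    in the left kernel. *)
Lemma sum_supp_F2 (n r : nat) (u : 'rV['F_2]_n) (x : 'I_n -> 'rV['F_2]_r) :
  \sum_(j in supp u) x j = u *m \matrix_j x j.
Proof.
rewrite mulmx_sum_row big_mkcond; apply: eq_bigr => j _.
rewrite rowK inE; have [-> | ] := eqVneq (u 0 j) 0; first by rewrite scale0r.
by rewrite F2_neq0 => /eqP ->; rewrite scale1r.
Qed.

Lemma Dk_prop_C2pow_2 (r l : nat) :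
  (3 * r + 4 <= 2 * l)%N -> Dk_prop (C2pow r) 2 l.
Proof.
move=> hl s hs; set n := size s in hs.
pose A : 'M['F_2]_(n, r) := \matrix_j (nth 0 s j : 'rV['F_2]_r).
have rkK : (n - r <= \rank (kermx A))%N.
  by rewrite mxrank_ker leq_sub2l // rank_leq_col.
have [/existsP [u /existsP [v]] | none] := boolP [exists u : 'rV['F_2]_n,
    [exists v : 'rV['F_2]_n, [&& (u <= kermx A)%MS, (v <= kermx A)%MS,
      u != 0, v != 0 & [disjoint supp u & supp v]]]].
  case/and5P=> /sub_kermxP uA /sub_kermxP vA nzu nzv duv.
  exists (fun i : 'I_2 => if i == 0 then supp u else supp v); split; last split.
  - by move=> i; case: ifP => _; rewrite supp_eq0.
  - by move=> i; case: ifP => _; rewrite [LHS]sum_supp_F2.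
  - by case=> [[|[|]]] // ? [[|[|]]] //= ? _; rewrite // disjoint_sym.
have := @intersecting_code_length _ _ (kermx A).
have int (u v : 'rV_n) : (u <= kermx A)%MS -> (v <= kermx A)%MS ->
    u != 0 -> v != 0 -> ~~ [disjoint supp u & supp v].
  move=> uK vK nzu nzv; apply: contra none => duv.
  by apply/existsP; exists u; apply/existsP; exists v; rewrite uK vK nzu nzv.
(* The rank is at least [n - r], so [3 * (n - r - 1) <= n], which contradicts
   [3 * r + 4 <= 2 * n]. *)
move/(_ int); lia.
Qed.

(* D_2(C_2^r) < (3r+6)/2, i.e. 2 * D_2(C_2^r) < 3r + 6. *)
Theorem theorem7p8 (r : nat) :
  exists l : nat, is_Dk (C2pow r) 2 l /\ (2 * l < 3 * r + 6)%N.
Proof.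
(* This is [(3 * r + 4) / 2] rounded up, so [2 * l0 <= 3 * r + 5]. *)
pose l0 := ((3 * r + 5) %/ 2)%N.
have Dl0 : Dk_prop (C2pow r) 2 l0 by apply: Dk_prop_C2pow_2; rewrite /l0; lia.
have [] := @dec_inh_nat_subset_has_unique_least_element (Dk_prop (C2pow r) 2).
- by move=> l; apply: classic.
- by exists l0.
move=> l [[Dl minl] _]; exists l; split.
  by split=> // l' /minl /leP.
have /leP := minl _ Dl0; rewrite /l0; lia.
Qed.
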